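(* Let $\Delta\subseteq L$ be a set of formulas, $\alpha\in L$ a formula, and $p,q\in(0,1]$ with $p\ge q$. Then $\Delta\vDash_c\alpha$ if and only if $\Delta\vDash_p^q\alpha$.
   Context: $B=\{B_j: j\in\mathbb N\}$ is a denumerable set of propositional symbols and $L$ is the set of propositional formulas generated from $B$ by $\neg$ and $\supset$ (other connectives are the usual abbreviations). A valuation $v:B\to\{0,1\}$ is identified with the subset $\{B_j: v(B_j)=1\}$ of $B$; $v\Vdash_c\alpha$ is classical satisfaction; $\Delta\vDash_c\alpha$ means that every valuation satisfying all members of $\Delta$ satisfies $\alpha$. $B_\alpha$ is the set of symbols occurring in $\alpha$ and $[\![\alpha]\!]=\{v\cap B_\alpha : v\Vdash_c\alpha\}$. A stochastic valuation $V$ is a family $\{V_{B_j}\}_{B_j\in B}$ of random variables on a probability space $(\Omega,\mathcal F,\mu)$, where $V_{B_j}$ takes values in $\{\emptyset,\{B_j\}\}$ ($\emptyset$ for false, $\{B_j\}$ for true). For finite non-empty $A\subseteq B$ and $U\subseteq A$, $\mathrm{Prob}(V_A=U)=\mu\big(\bigcap_{B_j\in A}V_{B_j}^{-1}(U\cap\{B_j\})\big)$. For $\alpha\in L$, $\mathrm{Prob}_V(\alpha)=\sum_{U\in[\![\alpha]\!]}\mathrm{Prob}(V_{B_\alpha}=U)$. For $p\in[0,1]$, $V\Vdash_p\alpha$ means $\mathrm{Prob}_V(\alpha)\ge p$. For $p,q\in(0,1]$ with $p\ge q$, $\Delta\vDash_p^q\alpha$ means: there is a finite subset $\Phi$ of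 $\Delta$ such that, for every stochastic valuation $V$, if $V\Vdash_p\bigwedge\Phi$ then $V\Vdash_q\alpha$. Here $\bigwedge\Phi$ is the conjunction of the formulas in $\Phi$, with $\bigwedge\emptyset$ being verum (a fixed tautology). *)

(* Defs.v *)
From HB Require Import structures.
From mathcomp Require Import all_boot all_order all_algebra finmap.
From mathcomp Require Import all_classical all_reals all_analysis.

Set Implicit Arguments.
Unset Strict Implicit.
Unset Printing Implicit Defensive.

Import Order.TTheory GRing.Theory Num.Theory.

Local Open Scope classical_set_scope.
Local Open Scope ring_scope.

(* The propositional symbol B_j is represented by its index j : nat. *)
Inductive formula : Type :=
| Sym of nat
| Neg of formula
| Imp of formula & formula.

(* Classical equality and choice on formulas, so that {fset formula} is
   available. *)
HB.instance Definition _ := gen_eqMixin formula.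
HB.instance Definition _ := gen_choiceMixin formula.

Definition Conj (a b : formula) : formula := Neg (Imp a (Neg b)).

Definition Verum : formula := Imp (Sym 0) (Sym 0).

Fixpoint bigConj_seq (s : seq formula) : formula :=
  match s with
  | [::] => Verum
  | [:: a] => a
  | a :: s' => Conj a (bigConj_seq s')
  end.

(* The conjuncts are taken in the order in which Phi is enumerated. *)
Definition bigConj (Phi : {fset formula}) : formula := bigConj_seq (enum_fset Phi).

Fixpoint symbols (a : formula) : {fset nat} :=
  match a with
  | Sym j => [fset j]%fset
  | Neg b => symbols b
  | Imp b c => (symbols b `|` symbols c)%fset
  end.

(* v is identified with the set of the j such that v j = true. *)
Definition valuation : Type := nat -> bool.

Fixpoint satisfies (v : valuation) (a : formula) : bool :=
  match a with
  | Sym j => v j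
  | Neg b => ~~ satisfies v b
  | Imp b c => satisfies v b ==> satisfies v c
  end.

Definition classical_entails (Delta : set formula) (a : formula) : Prop :=
  forall v : valuation,
    (forall b, Delta b -> satisfies v b) -> satisfies v a.

Definition restrict_valuation (v : valuation) (A : {fset nat}) : {fset nat} :=
  [fset j in A | v j]%fset.

Definition models (a : formula) : set {fset nat} :=
  [set restrict_valuation v (symbols a) | v in [set v | satisfies v a]].

Lemma finite_models (a : formula) : finite_set (models a).
Proof.
apply: (@sub_finite_set _ _ [set` fpowerset (symbols a)]).
  move=> _ [v _ <-] /=; rewrite fpowersetE; exact: fset_sub.
exact: finite_fset.
Qed.

(* The values {B_j} and the empty set of the j-th random variable are
   represented by true and false. *)
Definition stochastic_valuation (R : realType) (d : measure_display)
    (Omega : measurableType d) (mu : probability Omega R) : Type :=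
  nat -> {RV mu >-> bool}.

Section stochastic_satisfaction.
Context (R : realType) (d : measure_display) (Omega : measurableType d).
Context (mu : probability Omega R) (V : stochastic_valuation mu).

Local Open Scope ereal_scope.

(* Prob(V_A = U): under the encoding above, the value obtained by intersecting
   U with {B_j} is the boolean j \in U. *)
Definition prob_eq (A U : {fset nat}) : \bar R :=
  mu (\bigcap_(j in [set` A]) (V j @^-1` [set j \in U])).

(* The sum ranges over a finite set, by finite_models. *)
Definition prob_formula (a : formula) : \bar R :=
  \sum_(U \in models a) prob_eq (symbols a) U.

Definition stochastic_satisfies (p : R) (a : formula) : Prop :=
  p%:E <= prob_formula a.

End stochastic_satisfaction.

Definition stochastic_entails (R : realType) (p q : R)
    (Delta : set formula) (a : formula) : Prop :=
  exists2 Phi : {fset formula}, [set` Phi] `<=` Delta &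
    forall (d : measure_display) (Omega : measurableType d)
      (mu : probability Omega R) (V : stochastic_valuation mu),
      stochastic_satisfies V p (bigConj Phi) -> stochastic_satisfies V q a.

(* Main.v *)
Require Import Defs.
From mathcomp Require Import all_boot all_order all_algebra finmap.
From mathcomp Require Import all_classical all_reals all_analysis.

(* Prob_V(alpha) is the measure of the event that the random valuation
   w |-> (j |-> V j w) satisfies alpha.  Hence, once compactness of the Cantor
   space of valuations provides a finite Phi with Phi |= alpha, the event for
   /\Phi is contained in the event for alpha.  Conversely, a classical valuation
   is a stochastic valuation under a Dirac measure, whose only probabilities
   are 0 and 1, and 0 < q <= p <= 1. *)

Import Order.TTheory GRing.Theory Num.Theory.

Local Open Scope ring_scope.

Lemma eq_satisfies (v w : valuation) (a : formula) :
  {in symbols a, v =1 w} -> satisfies v a = satisfies w a.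
Proof.
elim: a => [j|b IHb|b IHb c IHc] /= vw; first by apply: vw; rewrite inE.
  by rewrite IHb.
by rewrite IHb ?IHc// => j j_in; apply: vw; rewrite inE j_in ?orbT.
Qed.

Lemma satisfies_bigConj (v : valuation) (Phi : {fset formula}) :
  satisfies v (bigConj Phi) = all (satisfies v) (enum_fset Phi).
Proof.
rewrite /bigConj; elim: (enum_fset Phi) => [|a [|b s] IHs].
- by rewrite /= implybb.
- by rewrite /= andbT.
- transitivity (satisfies v a && satisfies v (bigConj_seq (b :: s))).
    by rewrite /= negb_imply negbK.
  by rewrite IHs.
Qed.

(** Coordinate projections to the discrete space [bool] are continuous, and clopen sets are stable
    under complement and union. Both halves serve compactness: closedness for the set to be covered,
    openness for the sets covering it. *)
Lemma clopen_satisfies (a : formula) :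
  clopen ([set v : cantor_space | satisfies v a])%classic.
Proof.
elim: a => [j|b IHb|b IHb c IHc].
- apply: (@preimage_clopen cantor_space bool (fun v => v j) [set x | x]%classic).
    by split; [exact: discrete_open|exact: discrete_closed].
  exact: (@proj_continuous _ (fun=> bool) j).
- rewrite [X in clopen X](_ : _ = ~` [set v : cantor_space | satisfies v b])%classic.
    exact: (clopenC set0).
  by apply/seteqP; split=> v /= /negP.
- rewrite [X in clopen X](_ : _ = ~` [set v : cantor_space | satisfies v b] `|`
      [set v : cantor_space | satisfies v c])%classic.
    by apply: clopenU => //; exact: (clopenC set0).
  apply/seteqP; split=> v /=; rewrite implybE.
    by case/orP => [/negP|]; [left|right].
  by case=> [/negP ->//|->]; rewrite orbT.
Qed.

Lemma classical_compactness (Delta : set formula) (a : formula) :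
  classical_entails Delta a ->
  exists2 Phi : {fset formula}, ([set` Phi] `<=` Delta)%classic &
    forall v, satisfies v (bigConj Phi) -> satisfies v a.
Proof.
move=> Delta_a.
have [_ closedNa] := clopenC set0 (clopen_satisfies a).
have := subclosed_compact closedNa cantor_space_compact (fun _ _ => I).
(* The closed set of valuations falsifying [a] is compact. The cover is indexed by [Delta] itself,
   so that a finite subcover is already the desired [Phi]. *)
rewrite compact_cover => /(_ _ Delta
  (fun b => ~` [set v : cantor_space | satisfies v b])%classic) [].
- by move=> b _; have [] := clopenC set0 (clopen_satisfies b).
(* Covering is the contrapositive of entailment: a valuation falsifying [a] falsifies some member of
   [Delta]. *)
- move=> v va; apply: contrapT => vN; apply: va; apply: Delta_a => b Db.
  by apply: contrapT => vb; apply: vN; exists b.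
- move=> Phi PhiD cov; exists Phi; first by move=> b /PhiD; rewrite inE.
  move=> v; rewrite satisfies_bigConj => /allP vPhi.
  by apply: contrapT => /cov [b /= /vPhi vb]; apply.
Qed.

Section stochastic_event.
Context (R : realType) (d : measure_display) (Omega : measurableType d).
Context (mu : probability Omega R) (V : stochastic_valuation mu).
Local Open Scope classical_set_scope.

Definition satisfaction_event (a : formula) : set Omega :=
  [set w | satisfies (fun j => V j w) a].

Let cell (A U : {fset nat}) : set Omega :=
  \bigcap_(j in [set` A]) (V j @^-1` [set j \in U]).

Let measurable_cell (A U : {fset nat}) : measurable (cell A U).
Proof.
apply: fin_bigcap_measurable => // j _.
by rewrite -[X in measurable X]setTI; apply: measurable_funP.
Qed.

(** An outcome in a cell determines its index, which makes distinct cells disjoint. The inclusion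
    matters because a cell only sees the part of [U] inside [A]. *)
Let cell_restrict (A U : {fset nat}) (w : Omega) :
  (U `<=` A)%fset -> cell A U w ->
  U = restrict_valuation (fun j => V j w) A.
Proof.
move=> /fsubsetP UA wU; apply/fsetP => j; rewrite /restrict_valuation !inE.
case: (boolP (j \in A)) => [jA|jA] /=; first by rewrite (wU _ jA).
by apply/negbTE; apply: contra jA => /UA.
Qed.

Let sub_symbols (a : formula) (U : {fset nat}) :
  models a U -> (U `<=` symbols a)%fset.
Proof. by case=> v _ <-; exact: fset_sub. Qed.

(** Truth of [a] depends only on its symbols, so each outcome can be sorted by the restriction of
    its valuation to them. *)
Lemma satisfaction_eventE (a : formula) :
  satisfaction_event a = \bigcup_(U in models a) cell (symbols a) U.
Proof.
apply/seteqP; split=> w /=.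
  move=> wa; exists (restrict_valuation (fun j => V j w) (symbols a)).
    by exists (fun j => V j w).
  by move=> j /= ja; rewrite /restrict_valuation !inE ja.
case=> _ [v /= va <-] wv; rewrite /satisfaction_event /= -(eq_satisfies v) //.
by move=> j ja; rewrite (wv _ ja) /restrict_valuation !inE ja.
Qed.

Lemma measurable_satisfaction_event (a : formula) :
  measurable (satisfaction_event a).
Proof.
rewrite satisfaction_eventE; apply: fin_bigcup_measurable => //.
exact: finite_models.
Qed.

(** Finite additivity: the cells indexed by [models a] are measurable, pairwise disjoint and finite
    in number. *)
Lemma prob_formulaE (a : formula) :
  prob_formula V a = mu (satisfaction_event a).
Proof.
rewrite satisfaction_eventE measure_fin_bigcup //; first exact: finite_models.
move=> U W /sub_symbols Ua /sub_symbols Wa [w [wU wW]].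
by rewrite (cell_restrict _ _ _ Ua wU) (cell_restrict _ _ _ Wa wW).
Qed.

End stochastic_event.

(** Constant random variables on a one-point space: the single outcome realizes [v]. *)
Definition dirac_valuation (R : realType) (v : valuation) :
    stochastic_valuation (\d_tt : probability unit R) :=
  fun j => (cst (v j) : {mfun unit >-> bool}).

Lemma prob_formula_dirac (R : realType) (v : valuation) (a : formula) :
  prob_formula (dirac_valuation R v) a = ((satisfies v a)%:R%:E)%E.
Proof.
rewrite prob_formulaE [LHS]diracE.
by congr (nat_of_bool _)%:R%:E%E; apply/idP/idP; rewrite inE.
Qed.

Theorem theorem3p4 (R : realType) (Delta : set formula) (alpha : formula)
    (p q : R) (hp0 : 0 < p) (hp1 : p <= 1) (hq0 : 0 < q) (hq1 : q <= 1)
    (hqp : q <= p) :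
  classical_entails Delta alpha <-> stochastic_entails p q Delta alpha.
Proof.
split=> [/classical_compactness [Phi PhiD Phi_alpha]|[Phi PhiD Phi_alpha] v vD].
  exists Phi => // d Omega mu V; rewrite /stochastic_satisfies !prob_formulaE.
  (* The chain is [q <= p], then [p] is at most the probability of the conjunction, which
     monotonicity of [mu] bounds by that of [alpha]. *)
  move=> pPhi; rewrite (@le_trans _ _ p%:E)%E ?lee_fin// (le_trans pPhi)//.
  apply: le_measure; rewrite ?inE; try exact: measurable_satisfaction_event.
  by move=> w; apply: Phi_alpha.
have := Phi_alpha _ _ _ (dirac_valuation R v).
rewrite /stochastic_satisfies !prob_formula_dirac !lee_fin satisfies_bigConj.
have -> : all (satisfies v) (enum_fset Phi).
  by apply/allP => b bPhi; apply: vD; apply: PhiD.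
(* The conjunction has probability 1, hence at least [p]; were [alpha] false at [v], its probability
   0 would have to be at least [q]. *)
by move=> /(_ hp1); case: (satisfies v alpha) => //; rewrite leNgt hq0.
Qed.
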